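(* Let $(\mathcal{A},\mathcal{B},\mathcal{C})$ be a recollement of extriangulated categories with functors $i^{*},i_{*},i^{!},j_{!},j^{*},j_{*}$, and let $(\mathcal{T}_{1},\mathcal{F}_{1})$ and $(\mathcal{T}_{2},\mathcal{F}_{2})$ be cotorsion pairs in $\mathcal{A}$ and $\mathcal{C}$, respectively. Let $(\mathcal{T},\mathcal{F})$ be the glued pair with respect to $(\mathcal{T}_{1},\mathcal{F}_{1})$ and $(\mathcal{T}_{2},\mathcal{F}_{2})$, i.e. $\mathcal{T}=\{B\in\mathcal{B}\mid i^{*}B\in\mathcal{T}_{1},\ j^{*}B\in\mathcal{T}_{2}\}$ and $\mathcal{F}=\{B\in\mathcal{B}\mid i^{!}B\in\mathcal{F}_{1},\ j^{*}B\in\mathcal{F}_{2}\}$. Assume that $\mathcal{B}$ has enough projectives and that $i^{!}$ and $j_{!}$ are exact functors. (1) If one of the following conditions holds: (i) $\mathbb{E}_{\mathcal{B}}(\mathcal{T},\mathcal{F})=0$; (ii) $i^{*}$ is exact; (iii) for any morphism $f:i_{*}A\to j_{!}T$ with $A\in\mathcal{A}$ and $T\in\mathcal{T}_{2}$, the induced map $f^{*}:\mathrm{Hom}_{\mathcal{B}}(j_{!}T,F)\to\mathrm{Hom}_{\mathcal{B}}(i_{*}A,F)$ is surjective for any $F\in\mathcal{F}$; (iv) $\mathcal{T}\subseteq j_{!}\mathcal{T}_{2}$ or $i_{*}\mathcal{F}_{1}\subseteq\mathcal{T}^{\perp_{1}}$; (v) $\mathcal{A}$ and $\mathcal{B}$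 are Frobenius extriangulated categories; then $(\mathcal{T},\mathcal{F})$ is a cotorsion pair in $\mathcal{B}$. (2) If $(\mathcal{U},\mathcal{V})$ is a cotorsion pair in $\mathcal{B}$ such that $i_{*}i^{!}\mathcal{U}\subseteq\mathcal{U}$ and $i_{*}i^{*}\mathcal{U}\subseteq\mathcal{U}$, then $(i^{*}\mathcal{U},i^{!}\mathcal{V})$ is a cotorsion pair in $\mathcal{A}$. (3) If $(\mathcal{U},\mathcal{V})$ is a cotorsion pair in $\mathcal{B}$ such that $j_{*}j^{*}\mathcal{V}\subseteq\mathcal{V}$ or $j_{!}j^{*}\mathcal{U}\subseteq\mathcal{U}$, then $(j^{*}\mathcal{U},j^{*}\mathcal{V})$ is a cotorsion pair in $\mathcal{C}$.
   Context: **Extriangulated categories (Nakaoka–Palu).** All subcategories are full and closed under isomorphisms. Let $\mathscr{C}$ be an additive category and $\mathbb{E}:\mathscr{C}^{op}\times\mathscr{C}\to Ab$ a biadditive functor. An element $\delta\in\mathbb{E}(C,A)$ is an $\mathbb{E}$-extension; for $a:A\to A'$ and $c:C'\to C$ write $a_{*}\delta=\mathbb{E}(C,a)(\delta)$, $c^{*}\delta=\mathbb{E}(c,A)(\delta)$. A morphism $(a,c):\delta\to\delta'$ of extensions $\delta\in\mathbb{E}(C,A)$, $\delta'\in\mathbb{E}(C',A')$ is a pair $a:A\to A'$, $c:C\to C'$ with $a_{*}\delta=c^{*}\delta'$. Sequences $A\xrightarrow{x}B\xrightarrow{y}C$ and $A\xrightarrow{x'}B'\xrightarrow{y'}C$ are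 equivalent if there is an isomorphism $b:B\to B'$ with $bx=x'$, $y'b=y$; equivalence classes are denoted $[A\to B\to C]$. A realization $\mathfrak{s}$ assigns to each $\delta\in\mathbb{E}(C,A)$ an equivalence class $\mathfrak{s}(\delta)=[A\xrightarrow{x}B\xrightarrow{y}C]$ such that for each morphism $(a,c):\delta\to\delta'$, with $\mathfrak{s}(\delta')=[A'\xrightarrow{x'}B'\xrightarrow{y'}C']$, there is $b:B\to B'$ with $bx=x'a$, $y'b=cy$ (then $(a,b,c)$ realizes $(a,c)$). It is additive if $\mathfrak{s}(0)=[A\to A\oplus C\to C]$ (canonical inclusion and projection) and $\mathfrak{s}(\delta\oplus\delta')=\mathfrak{s}(\delta)\oplus\mathfrak{s}(\delta')$. $(\mathscr{C},\mathbb{E},\mathfrak{s})$ is extriangulated if $\mathbb{E}$ is biadditive, $\mathfrak{s}$ is an additive realization, and: (ET3) if $\mathfrak{s}(\delta)=[A\xrightarrow{x}B\xrightarrow{y}C]$, $\mathfrak{s}(\delta')=[A'\xrightarrow{x'}B'\xrightarrow{y'}C']$ and $bx=x'a$, then there is a morphism $(a,c):\delta\to\delta'$ realized by $(a,b,c)$; (ET3)$^{op}$ the dual; (ET4) if $\delta\in\mathbb{E}(D,A)$, $\delta'\in\mathbb{E}(F,B)$ are realized by $A\xrightarrow{f}B\xrightarrow{f'}D$ and $B\xrightarrow{g}C\xrightarrow{g'}F$, then there are an object $E$, an extension $\delta''\in\mathbb{E}(E,A)$ realized by $A\xrightarrow{h}C\xrightarrow{h'}E$, and $d:D\to E$, $e:E\to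 F$ with $h=gf$, $h'g=df'$, $eh'=g'$, such that $D\xrightarrow{d}E\xrightarrow{e}F$ realizes $f'_{*}\delta'$, $d^{*}\delta''=\delta$, and $f_{*}\delta''=e^{*}\delta'$; (ET4)$^{op}$ the dual. If $\mathfrak{s}(\delta)=[A\xrightarrow{x}B\xrightarrow{y}C]$, then $A\xrightarrow{x}B\xrightarrow{y}C$ is a conflation, $x$ an inflation, $y$ a deflation, and $A\xrightarrow{x}B\xrightarrow{y}C\overset{\delta}{\dashrightarrow}$ an $\mathbb{E}$-triangle. **Standing assumption (WIC)** on every extriangulated category: if $gf$ is an inflation then $f$ is an inflation; if $gf$ is a deflation then $g$ is a deflation. **Projectives, injectives.** $P$ is projective if for every conflation $A\to B\xrightarrow{y}C$ and $c:P\to C$ there is $b:P\to B$ with $yb=c$; injectives are dual. $\mathscr{C}$ has enough projectives if every $M$ admits an $\mathbb{E}$-triangle $A\to P\to M\dashrightarrow$ with $P$ projective; enough injectives is dual. $\mathscr{C}$ is Frobenius if it has enough projectives and enough injectives and the projectives coincide with the injectives. **Compatible morphisms; one-sided exact sequences.** A morphism $f$ is compatible if ``$f$ is both an inflation and a deflation'' implies that $f$ is an isomorphism. A sequence $A\xrightarrow{f}B\xrightarrow{g}C$ is right exact if there are an $\mathbb{E}$-triangle $K\xrightarrow{h_{2}}B\xrightarrow{g}C\dashrightarrow$ and a compatible deflation $h_{1}:A\to K$ with $f=h_{2}h_{1}$; it is left exact if there are an $\mathbb{E}$-triangle $A\xrightarrow{f}B\xrightarrow{h_{1}}K\dashrightarrow$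 and a compatible inflation $h_{2}:K\to C$ with $g=h_{2}h_{1}$. A 4-term $\mathbb{E}$-triangle sequence $A\xrightarrow{f}B\xrightarrow{g}C\xrightarrow{h}D$ is right exact (resp. left exact) if there are $\mathbb{E}$-triangles $A\xrightarrow{f}B\xrightarrow{g_{1}}K\dashrightarrow$ and $K\xrightarrow{g_{2}}C\xrightarrow{h}D\dashrightarrow$ with $g=g_{2}g_{1}$ and $g_{1}$ (resp. $g_{2}$) compatible. **Exact functors.** Let $F:\mathcal{A}\to\mathcal{B}$ be an additive covariant functor between extriangulated categories. - $F$ is exact if (1) $F$ sends compatible morphisms to compatible morphisms; (2) there is a natural transformation $\eta:\mathbb{E}_{\mathcal{A}}(-,-)\Rightarrow\mathbb{E}_{\mathcal{B}}(F-,F-)$; (3) if $\mathfrak{s}_{\mathcal{A}}(\delta)=[A\xrightarrow{x}B\xrightarrow{y}C]$ then $\mathfrak{s}_{\mathcal{B}}(\eta_{(C,A)}(\delta))=[FA\xrightarrow{Fx}FB\xrightarrow{Fy}FC]$. - $F$ is right exact if (1) $F$ sends compatible morphisms to compatible morphisms; (2) $F$ sends right exact sequences to right exact sequences (so for each $\mathbb{E}_{\mathcal{A}}$-triangle $A\xrightarrow{f}B\xrightarrow{g}C\overset{\delta}{\dashrightarrow}$ there are an $\mathbb{E}_{\mathcal{B}}$-triangle $A'\xrightarrow{x}FB\xrightarrow{Fg}FC\dashrightarrow$ and a compatible deflation $y:FA\to A'$ with $Ff=xy$, where $A'$ is unique up to isomorphism); (3) there is a natural assignment $\eta_{(C,A)}:\delta\mapsto\eta_{(C,A)}(\delta)\in\mathbb{E}_{\mathcal{B}}(FC,A')$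 with $\mathfrak{s}_{\mathcal{B}}(\eta_{(C,A)}(\delta))=[A'\xrightarrow{x}FB\xrightarrow{Fg}FC]$; naturality: for each morphism $(a,c):\delta_{1}\to\delta_{2}$ of $\mathbb{E}_{\mathcal{A}}$-extensions, with associated $y_{k}:FA_{k}\to A'_{k}$ ($k=1,2$), there is $a':A'_{1}\to A'_{2}$ with $a'y_{1}=y_{2}F(a)$ and $a'_{*}\eta(\delta_{1})=(Fc)^{*}\eta(\delta_{2})$. - Left exact functors are defined dually. **Recollement.** For extriangulated categories $\mathcal{A},\mathcal{B},\mathcal{C}$, a recollement $(\mathcal{A},\mathcal{B},\mathcal{C})$ consists of exact functors $i_{*}:\mathcal{A}\to\mathcal{B}$, $j^{*}:\mathcal{B}\to\mathcal{C}$, right exact functors $i^{*}:\mathcal{B}\to\mathcal{A}$, $j_{!}:\mathcal{C}\to\mathcal{B}$, and left exact functors $i^{!}:\mathcal{B}\to\mathcal{A}$, $j_{*}:\mathcal{C}\to\mathcal{B}$ such that: (R1) $(i^{*},i_{*},i^{!})$ and $(j_{!},j^{*},j_{*})$ are adjoint triples; (R2) $\mathrm{Im}\,i_{*}=\mathrm{Ker}\,j^{*}$; (R3) $i_{*},j_{!},j_{*}$ are fully faithful; (R4) for each $X\in\mathcal{B}$ there is a left exact $\mathbb{E}_{\mathcal{B}}$-triangle sequence $i_{*}i^{!}X\xrightarrow{\theta_{X}}X\xrightarrow{\vartheta_{X}}j_{*}j^{*}X\to i_{*}A$ with $A\in\mathcal{A}$, $\theta_X,\vartheta_X$ the adjunction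 morphisms; (R5) for each $X\in\mathcal{B}$ there is a right exact $\mathbb{E}_{\mathcal{B}}$-triangle sequence $i_{*}A'\to j_{!}j^{*}X\xrightarrow{\upsilon_{X}}X\xrightarrow{\nu_{X}}i_{*}i^{*}X$ with $A'\in\mathcal{A}$, $\upsilon_X,\nu_X$ the adjunction morphisms. **Cotorsion pairs.** A pair $(\mathcal{T},\mathcal{F})$ of subcategories of $\mathscr{C}$ is a cotorsion pair if (a) $\mathbb{E}(\mathcal{T},\mathcal{F})=0$; (b) each $C\in\mathscr{C}$ admits a conflation $F\to T\to C$ with $F\in\mathcal{F}$, $T\in\mathcal{T}$; (c) each $C\in\mathscr{C}$ admits a conflation $C\to F'\to T'$ with $F'\in\mathcal{F}$, $T'\in\mathcal{T}$. Write $\mathcal{X}^{\perp_{1}}=\{M\in\mathscr{C}\mid\mathbb{E}(\mathcal{X},M)=0\}$. For a functor $G$ and a subcategory $\mathcal{X}$, $G\mathcal{X}$ is the full subcategory of objects isomorphic to $GX$ with $X\in\mathcal{X}$. *)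

(* Defs.v *)
From mathcomp Require Import all_boot ssralg.

Set Implicit Arguments.
Unset Strict Implicit.
Unset Printing Implicit Defensive.
Set Primitive Projections.

Import GRing.Theory.
Local Open Scope ring_scope.

(** Hom-groups (and, below, extension groups) are zmodTypes. The choice structure
    this carries is no restriction classically. *)
Record PreaddCat := {
  Obj :> Type;
  Mor : Obj -> Obj -> zmodType;
  idmor : forall X, Mor X X;
  mcomp : forall X Y Z, Mor Y Z -> Mor X Y -> Mor X Z;
  comp_idl : forall X Y (f : Mor X Y), mcomp (idmor Y) f = f;
  comp_idr : forall X Y (f : Mor X Y), mcomp f (idmor X) = f;
  comp_assoc : forall X Y Z W (h : Mor Z W) (g : Mor Y Z) (f : Mor X Y),
    mcomp h (mcomp g f) = mcomp (mcomp h g) f;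
  compDl : forall X Y Z (g g' : Mor Y Z) (f : Mor X Y),
    mcomp (g + g') f = mcomp g f + mcomp g' f;
  compDr : forall X Y Z (g : Mor Y Z) (f f' : Mor X Y),
    mcomp g (f + f') = mcomp g f + mcomp g f'
}.

Arguments idmor {p} X.

Notation "g ∘ f" := (mcomp g f) (at level 40, left associativity).

Definition is_zero_object (C : PreaddCat) (Z : C) : Prop :=
  forall X : C, (forall f : Mor X Z, f = 0) /\ (forall f : Mor Z X, f = 0).

Record is_biproduct (C : PreaddCat) (A B S : C)
    (i1 : Mor A S) (i2 : Mor B S) (p1 : Mor S A) (p2 : Mor S B) : Prop := {
  biprod11 : p1 ∘ i1 = idmor A;
  biprod22 : p2 ∘ i2 = idmor B;
  biprod12 : p1 ∘ i2 = 0;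
  biprod21 : p2 ∘ i1 = 0;
  biprod_id : i1 ∘ p1 + i2 ∘ p2 = idmor S
}.

Record AddCat := {
  precat :> PreaddCat;
  has_zero : exists Z : precat, is_zero_object Z;
  has_biproducts : forall A B : precat, exists S (i1 : Mor A S) (i2 : Mor B S)
    (p1 : Mor S A) (p2 : Mor S B), is_biproduct i1 i2 p1 p2
}.

Definition is_iso (C : PreaddCat) (X Y : C) (f : Mor X Y) : Prop :=
  exists g : Mor Y X, g ∘ f = idmor X /\ f ∘ g = idmor Y.

Definition isomorphic (C : PreaddCat) (X Y : C) : Prop :=
  exists f : Mor X Y, is_iso f.

(** A (full, isomorphism-closed) subcategory is given by its class of objects. *)
Definition is_subcategory (C : PreaddCat) (P : C -> Prop) : Prop :=
  forall X Y : C, isomorphic X Y -> P X -> P Y.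

Definition subcat_incl (C : PreaddCat) (P Q : C -> Prop) : Prop :=
  forall X : C, P X -> Q X.

Definition seq_equiv (C : PreaddCat) (X Z Y Y' : C)
    (x : Mor X Y) (y : Mor Y Z) (x' : Mor X Y') (y' : Mor Y' Z) : Prop :=
  exists b : Mor Y Y', [/\ is_iso b, b ∘ x = x' & y' ∘ b = y].

(** [ext C A] is E(C, A); [push a d] is a_* d and [pull c d] is c^* d. *)
Record Biadditive (CC : AddCat) := {
  ext : CC -> CC -> zmodType;
  push : forall C A A' : CC, Mor A A' -> ext C A -> ext C A';
  pull : forall C C' A : CC, Mor C' C -> ext C A -> ext C' A;
  push_id : forall (C A : CC) (d : ext C A), push (idmor A) d = d;
  pull_id : forall (C A : CC) (d : ext C A), pull (idmor C) d = d;
  push_comp : forall (C A A' A'' : CC) (a' : Mor A' A'') (a : Mor A A')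
    (d : ext C A), push (a' ∘ a) d = push a' (push a d);
  pull_comp : forall (C C' C'' A : CC) (c : Mor C' C) (c' : Mor C'' C')
    (d : ext C A), pull (c ∘ c') d = pull c' (pull c d);
  push_pull : forall (C C' A A' : CC) (a : Mor A A') (c : Mor C' C)
    (d : ext C A), push a (pull c d) = pull c (push a d);
  pushD : forall (C A A' : CC) (a : Mor A A') (d d' : ext C A),
    push a (d + d') = push a d + push a d';
  pullD : forall (C C' A : CC) (c : Mor C' C) (d d' : ext C A),
    pull c (d + d') = pull c d + pull c d';
  push_add : forall (C A A' : CC) (a a' : Mor A A') (d : ext C A),
    push (a + a') d = push a d + push a' d;
  pull_add : forall (C C' A : CC) (c c' : Mor C' C) (d : ext C A),
    pull (c + c') d = pull c d + pull c' d
}.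

(** The class s(d) is encoded by the relation [s d x y], meaning
    s(d) = [A -x-> B -y-> C]. *)
Definition realization_rel (CC : AddCat) (E : Biadditive CC) :=
  forall C A : CC, ext E C A -> forall B : CC, Mor A B -> Mor B C -> Prop.

Record is_realization (CC : AddCat) (E : Biadditive CC)
    (s : realization_rel E) : Prop := {
  real_nonempty : forall (C A : CC) (d : ext E C A),
    exists (B : CC) (x : Mor A B) (y : Mor B C), s C A d B x y;
  real_class : forall (C A : CC) (d : ext E C A) (B B' : CC)
    (x : Mor A B) (y : Mor B C) (x' : Mor A B') (y' : Mor B' C),
    s C A d B x y -> (s C A d B' x' y' <-> seq_equiv x y x' y');
  real_morphism : forall (C A C' A' : CC) (d : ext E C A) (d' : ext E C' A')
    (a : Mor A A') (c : Mor C C') (B B' : CC)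
    (x : Mor A B) (y : Mor B C) (x' : Mor A' B') (y' : Mor B' C'),
    push a d = pull c d' -> s C A d B x y -> s C' A' d' B' x' y' ->
    exists b : Mor B B', b ∘ x = x' ∘ a /\ y' ∘ b = c ∘ y
}.

(** In [real_sum], d ⊕ d' in E(C ⊕ C', A ⊕ A') is the extension with
    components (d, 0, 0, d'). *)
Record is_additive_realization (CC : AddCat) (E : Biadditive CC)
    (s : realization_rel E) : Prop := {
  real_real : is_realization s;
  real_zero : forall (A C S : CC)
    (i1 : Mor A S) (i2 : Mor C S) (p1 : Mor S A) (p2 : Mor S C),
    is_biproduct i1 i2 p1 p2 -> s C A 0 S i1 p2;
  real_sum : forall (A B C A' B' C' : CC) (d : ext E C A) (d' : ext E C' A')
    (x : Mor A B) (y : Mor B C) (x' : Mor A' B') (y' : Mor B' C')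
    (SA SB SC : CC)
    (iA : Mor A SA) (iA' : Mor A' SA) (pA : Mor SA A) (pA' : Mor SA A')
    (iB : Mor B SB) (iB' : Mor B' SB) (pB : Mor SB B) (pB' : Mor SB B')
    (iC : Mor C SC) (iC' : Mor C' SC) (pC : Mor SC C) (pC' : Mor SC C'),
    is_biproduct iA iA' pA pA' -> is_biproduct iB iB' pB pB' ->
    is_biproduct iC iC' pC pC' ->
    s C A d B x y -> s C' A' d' B' x' y' ->
    s SC SA (push iA (pull pC d) + push iA' (pull pC' d')) SB
      (iB ∘ x ∘ pA + iB' ∘ x' ∘ pA') (iC ∘ y ∘ pB + iC' ∘ y' ∘ pB')
}.

Record ExtriCat := {
  addcat :> AddCat;
  EE : Biadditive addcat;
  sreal : realization_rel EE;
  sreal_additive : is_additive_realization sreal;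
  ET3 : forall (A B C A' B' C' : addcat) (d : ext EE C A) (d' : ext EE C' A')
    (x : Mor A B) (y : Mor B C) (x' : Mor A' B') (y' : Mor B' C')
    (a : Mor A A') (b : Mor B B'),
    sreal d x y -> sreal d' x' y' -> b ∘ x = x' ∘ a ->
    exists c : Mor C C', push a d = pull c d' /\ y' ∘ b = c ∘ y;
  ET3op : forall (A B C A' B' C' : addcat) (d : ext EE C A) (d' : ext EE C' A')
    (x : Mor A B) (y : Mor B C) (x' : Mor A' B') (y' : Mor B' C')
    (b : Mor B B') (c : Mor C C'),
    sreal d x y -> sreal d' x' y' -> y' ∘ b = c ∘ y ->
    exists a : Mor A A', push a d = pull c d' /\ b ∘ x = x' ∘ a;
  ET4 : forall (A B C D F : addcat) (d1 : ext EE D A) (d2 : ext EE F B)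
    (f : Mor A B) (f' : Mor B D) (g : Mor B C) (g' : Mor C F),
    sreal d1 f f' -> sreal d2 g g' ->
    exists (E : addcat) (d3 : ext EE E A) (h : Mor A C) (h' : Mor C E)
      (d : Mor D E) (e : Mor E F),
      sreal d3 h h' /\
      [/\ h = g ∘ f, h' ∘ g = d ∘ f' & e ∘ h' = g'] /\
      [/\ sreal (push f' d2) d e,
          pull d d3 = d1
        & push f d3 = pull e d2];
  ET4op : forall (A B C D F : addcat) (d1 : ext EE A D) (d2 : ext EE B F)
    (f' : Mor D B) (f : Mor B A) (g' : Mor F C) (g : Mor C B),
    sreal d1 f' f -> sreal d2 g' g ->
    exists (E : addcat) (d3 : ext EE A E) (h' : Mor E C) (h : Mor C A)
      (d : Mor E D) (e : Mor F E),
      sreal d3 h' h /\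
      [/\ h = f ∘ g, g ∘ h' = f' ∘ d & h' ∘ e = g'] /\
      [/\ sreal (pull f' d2) e d,
          push d d3 = d1
        & pull f d3 = push e d2]
}.

Notation "'𝔼'" := (ext (EE _)) (only parsing).

(** [realizes d x y]: A -x-> B -y-> C - - d - -> is an E-triangle. *)
Definition realizes (CC : ExtriCat) (A B C : CC) (d : ext (EE CC) C A)
    (x : Mor A B) (y : Mor B C) : Prop := sreal d x y.

Record ETriangle (CC : ExtriCat) := {
  tA : CC; tB : CC; tC : CC;
  tf : Mor tA tB;
  tg : Mor tB tC;
  td : ext (EE CC) tC tA;
  t_real : realizes td tf tg
}.

Definition conflation (CC : ExtriCat) (A B C : CC)
    (x : Mor A B) (y : Mor B C) : Prop :=
  exists d : 𝔼 C A, realizes d x y.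

Definition inflation (CC : ExtriCat) (A B : CC) (x : Mor A B) : Prop :=
  exists (C : CC) (y : Mor B C), conflation x y.

Definition deflation (CC : ExtriCat) (B C : CC) (y : Mor B C) : Prop :=
  exists (A : CC) (x : Mor A B), conflation x y.

Definition WIC (CC : ExtriCat) : Prop :=
  (forall (A B C : CC) (f : Mor A B) (g : Mor B C),
     inflation (g ∘ f) -> inflation f) /\
  (forall (A B C : CC) (f : Mor A B) (g : Mor B C),
     deflation (g ∘ f) -> deflation g).

Definition projective (CC : ExtriCat) (P : CC) : Prop :=
  forall (A B C : CC) (x : Mor A B) (y : Mor B C), conflation x y ->
  forall c : Mor P C, exists b : Mor P B, y ∘ b = c.

Definition injective_obj (CC : ExtriCat) (I : CC) : Prop :=
  forall (A B C : CC) (x : Mor A B) (y : Mor B C), conflation x y ->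
  forall a : Mor A I, exists b : Mor B I, b ∘ x = a.

Definition enough_projectives (CC : ExtriCat) : Prop :=
  forall M : CC, exists (A P : CC) (x : Mor A P) (y : Mor P M),
    conflation x y /\ projective P.

Definition enough_injectives (CC : ExtriCat) : Prop :=
  forall M : CC, exists (I C : CC) (x : Mor M I) (y : Mor I C),
    conflation x y /\ injective_obj I.

Definition Frobenius (CC : ExtriCat) : Prop :=
  [/\ enough_projectives CC, enough_injectives CC
    & forall X : CC, projective X <-> injective_obj X].

Definition compatible (CC : ExtriCat) (X Y : CC) (f : Mor X Y) : Prop :=
  inflation f /\ deflation f -> is_iso f.

Definition right_exact_seq (CC : ExtriCat) (A B C : CC)
    (f : Mor A B) (g : Mor B C) : Prop :=
  exists (K : CC) (h2 : Mor K B) (h1 : Mor A K),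
    conflation h2 g /\ [/\ deflation h1, compatible h1 & f = h2 ∘ h1].

Definition left_exact_seq (CC : ExtriCat) (A B C : CC)
    (f : Mor A B) (g : Mor B C) : Prop :=
  exists (K : CC) (h1 : Mor B K) (h2 : Mor K C),
    conflation f h1 /\ [/\ inflation h2, compatible h2 & g = h2 ∘ h1].

Definition right_exact_seq4 (CC : ExtriCat) (A B C D : CC)
    (f : Mor A B) (g : Mor B C) (h : Mor C D) : Prop :=
  exists (K : CC) (g1 : Mor B K) (g2 : Mor K C),
    [/\ conflation f g1, conflation g2 h, g = g2 ∘ g1 & compatible g1].

Definition left_exact_seq4 (CC : ExtriCat) (A B C D : CC)
    (f : Mor A B) (g : Mor B C) (h : Mor C D) : Prop :=
  exists (K : CC) (g1 : Mor B K) (g2 : Mor K C),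
    [/\ conflation f g1, conflation g2 h, g = g2 ∘ g1 & compatible g2].

Record AddFunctor (A B : AddCat) := {
  fobj :> A -> B;
  fmor : forall X Y : A, Mor X Y -> Mor (fobj X) (fobj Y);
  fmor_id : forall X : A, fmor (idmor X) = idmor (fobj X);
  fmor_comp : forall (X Y Z : A) (g : Mor Y Z) (f : Mor X Y),
    fmor (g ∘ f) = fmor g ∘ fmor f;
  fmorD : forall (X Y : A) (f g : Mor X Y), fmor (f + g) = fmor f + fmor g
}.

Arguments fmor {A B} a {X Y} _.

Definition preserves_compatible (A B : ExtriCat) (F : AddFunctor A B) : Prop :=
  forall (X Y : A) (f : Mor X Y), compatible f -> compatible (fmor F f).

Definition exact_functor (A B : ExtriCat) (F : AddFunctor A B) : Prop :=
  preserves_compatible F /\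
  exists eta : forall Z X : A, ext (EE A) Z X -> ext (EE B) (F Z) (F X),
    [/\ (forall (Z X : A) (d d' : 𝔼 Z X), eta Z X (d + d') = eta Z X d + eta Z X d'),
        (forall (Z X X' : A) (a : Mor X X') (d : 𝔼 Z X),
           eta Z X' (push a d) = push (fmor F a) (eta Z X d)),
        (forall (Z Z' X : A) (c : Mor Z' Z) (d : 𝔼 Z X),
           eta Z' X (pull c d) = pull (fmor F c) (eta Z X d))
      & (forall (X Y Z : A) (d : 𝔼 Z X) (x : Mor X Y) (y : Mor Y Z),
           realizes d x y ->
           realizes (eta Z X d) (fmor F x) (fmor F y))].

(** The image of an E-triangle A -f-> B -g-> C under a right exact functor:
    A' -ra_x-> FB -Fg-> FC - - ra_eta - ->, with ra_y : FA -> A'. *)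
Record RightExactImage (A B : ExtriCat) (F : AddFunctor A B)
    (t : ETriangle A) := {
  ra_obj : B;
  ra_x : Mor ra_obj (F (tB t));
  ra_y : Mor (F (tA t)) ra_obj;
  ra_eta : ext (EE B) (F (tC t)) ra_obj;
  ra_defl : deflation ra_y;
  ra_compat : compatible ra_y;
  ra_factor : fmor F (tf t) = ra_x ∘ ra_y;
  ra_real : realizes ra_eta ra_x (fmor F (tg t))
}.

Definition right_exact_functor (A B : ExtriCat) (F : AddFunctor A B) : Prop :=
  [/\ preserves_compatible F,
      (forall (X Y Z : A) (f : Mor X Y) (g : Mor Y Z),
         right_exact_seq f g -> right_exact_seq (fmor F f) (fmor F g))
    & exists im : forall t : ETriangle A, RightExactImage F t,
        forall (t1 t2 : ETriangle A)
          (a : Mor (tA t1) (tA t2)) (c : Mor (tC t1) (tC t2)),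
          push a (td t1) = pull c (td t2) ->
          exists a' : Mor (ra_obj (im t1)) (ra_obj (im t2)),
            a' ∘ ra_y (im t1) = ra_y (im t2) ∘ fmor F a /\
            push a' (ra_eta (im t1)) = pull (fmor F c) (ra_eta (im t2))].

(** The image of an E-triangle A -f-> B -g-> C under a left exact functor:
    FA -Ff-> FB -la_x-> C' - - la_eta - ->, with la_y : C' -> FC. *)
Record LeftExactImage (A B : ExtriCat) (F : AddFunctor A B)
    (t : ETriangle A) := {
  la_obj : B;
  la_x : Mor (F (tB t)) la_obj;
  la_y : Mor la_obj (F (tC t));
  la_eta : ext (EE B) la_obj (F (tA t));
  la_infl : inflation la_y;
  la_compat : compatible la_y;
  la_factor : fmor F (tg t) = la_y ∘ la_x;
  la_real : realizes la_eta (fmor F (tf t)) la_x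
}.

Definition left_exact_functor (A B : ExtriCat) (F : AddFunctor A B) : Prop :=
  [/\ preserves_compatible F,
      (forall (X Y Z : A) (f : Mor X Y) (g : Mor Y Z),
         left_exact_seq f g -> left_exact_seq (fmor F f) (fmor F g))
    & exists im : forall t : ETriangle A, LeftExactImage F t,
        forall (t1 t2 : ETriangle A)
          (a : Mor (tA t1) (tA t2)) (c : Mor (tC t1) (tC t2)),
          push a (td t1) = pull c (td t2) ->
          exists c' : Mor (la_obj (im t1)) (la_obj (im t2)),
            la_y (im t2) ∘ c' = fmor F c ∘ la_y (im t1) /\
            push (fmor F a) (la_eta (im t1)) = pull c' (la_eta (im t2))].

Definition fully_faithful (A B : AddCat) (F : AddFunctor A B) : Prop :=
  forall X Y : A, bijective (@fmor A B F X Y).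

(** L is left adjoint to R. *)
Record Adjunction (A B : AddCat) (L : AddFunctor A B) (R : AddFunctor B A) := {
  unit_ : forall X : A, Mor X (R (L X));
  counit : forall Y : B, Mor (L (R Y)) Y;
  unit_nat : forall (X X' : A) (f : Mor X X'),
    unit_ X' ∘ f = fmor R (fmor L f) ∘ unit_ X;
  counit_nat : forall (Y Y' : B) (g : Mor Y Y'),
    counit Y' ∘ fmor L (fmor R g) = g ∘ counit Y;
  triangleL : forall X : A, counit (L X) ∘ fmor L (unit_ X) = idmor (L X);
  triangleR : forall Y : B, fmor R (counit Y) ∘ unit_ (R Y) = idmor (R Y)
}.

(** i_up = i^*, i_low = i_*, i_shr = i^!, j_shr = j_!, j_up = j^*, j_low = j_*. *)
Record Recollement (A B C : ExtriCat) := {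
  i_up : AddFunctor B A;
  i_low : AddFunctor A B;
  i_shr : AddFunctor B A;
  j_shr : AddFunctor C B;
  j_up : AddFunctor B C;
  j_low : AddFunctor C B;
  i_low_exact : exact_functor i_low;
  j_up_exact : exact_functor j_up;
  i_up_rexact : right_exact_functor i_up;
  j_shr_rexact : right_exact_functor j_shr;
  i_shr_lexact : left_exact_functor i_shr;
  j_low_lexact : left_exact_functor j_low;
  adj_i_up_low : Adjunction i_up i_low;
  adj_i_low_shr : Adjunction i_low i_shr;
  adj_j_shr_up : Adjunction j_shr j_up;
  adj_j_up_low : Adjunction j_up j_low;
  im_i_ker_j : forall X : B,
    (exists Y : A, isomorphic X (i_low Y)) <-> is_zero_object (j_up X);
  i_low_ff : fully_faithful i_low;
  j_shr_ff : fully_faithful j_shr;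
  j_low_ff : fully_faithful j_low;
  rec_left : forall X : B, exists (Y : A) (h : Mor (j_low (j_up X)) (i_low Y)),
    left_exact_seq4 (counit adj_i_low_shr X) (unit_ adj_j_up_low X) h;
  rec_right : forall X : B, exists (Y : A) (h : Mor (i_low Y) (j_shr (j_up X))),
    right_exact_seq4 h (counit adj_j_shr_up X) (unit_ adj_i_up_low X)
}.

Definition ext_vanishes (CC : ExtriCat) (T F : CC -> Prop) : Prop :=
  forall X Y : CC, T X -> F Y -> forall d : 𝔼 X Y, d = 0.

Definition cotorsion_pair (CC : ExtriCat) (T F : CC -> Prop) : Prop :=
  [/\ is_subcategory T, is_subcategory F, ext_vanishes T F,
      (forall X : CC, exists (Y Z : CC) (x : Mor Y Z) (y : Mor Z X),
         [/\ conflation x y, F Y & T Z])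
    & (forall X : CC, exists (Y Z : CC) (x : Mor X Y) (y : Mor Y Z),
         [/\ conflation x y, F Y & T Z])].

Definition perp1 (CC : ExtriCat) (P : CC -> Prop) : CC -> Prop :=
  fun M => forall X : CC, P X -> forall d : 𝔼 X M, d = 0.

(** The subcategory G P of objects isomorphic to G X with X in P. *)
Definition image_subcat (A B : AddCat) (G : AddFunctor A B) (P : A -> Prop) :
    B -> Prop :=
  fun Y => exists X : A, P X /\ isomorphic Y (G X).

Definition glued_T (A B C : ExtriCat) (R : Recollement A B C)
    (T1 : A -> Prop) (T2 : C -> Prop) : B -> Prop :=
  fun X => T1 (i_up R X) /\ T2 (j_up R X).

Definition glued_F (A B C : ExtriCat) (R : Recollement A B C)
    (F1 : A -> Prop) (F2 : C -> Prop) : B -> Prop :=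
  fun X => F1 (i_shr R X) /\ F2 (j_up R X).

(* Main.v *)
Require Import Defs.
From mathcomp Require Import all_boot ssralg.

Set Implicit Arguments.
Unset Strict Implicit.
Unset Printing Implicit Defensive.

Import GRing.Theory.
Local Open Scope ring_scope.

(** Why the theorem holds.

    Two mechanisms carry the proof. The first transfers the vanishing of
    extensions along an adjunction [L -| R]: when [R] preserves conflations,
    [E(X, R Y) = 0] implies [E(L X, Y) = 0], because the transpose of a lifting
    of the unit is a section ([ext_vanishes_L]); the converse holds when [L]
    preserves conflations ([ext_vanishes_R]). The second is that pushing out or
    pulling back an E-triangle along a counit or unit which an exact functor
    inverts leaves the middle term unchanged under that functor
    ([exact_pushout_middle], [exact_pullback_middle]).

    Exactness of [i^!] turns the left sequence of the recollement into a
    conflation [i_*i^!X -> X -> j_*j^*X] ([recollement_short_left]), and together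
    with (WIC) this makes [j_*] preserve conflations
    ([j_low_preserves_conflations]). All six functors but [i^*] then preserve
    conflations.

    Gluing. To embed [X] into an object of the glued class [F], one replaces
    [j^*X] by an object of [F2] through a pushout along [j_!j^*X -> X], then
    [i^!] of the result by an object of [F1] through a pushout along
    [i_*i^!Y -> Y]; the cokernel of the composite is an extension of [i_*T1] by
    [j_!T2], hence lies in [T] ([glued_coapproximation]). The other approximation
    is built by pullbacks along [X -> j_*j^*X] and [Y -> i_*i^*Y]
    ([glued_approximation]). So the glued pair is a cotorsion pair as soon as
    [E(T, F) = 0], and each of the conditions (ii)-(v) gives this vanishing.
    An object [W] of [T] is an extension of [i_*i^*W], which has no extensions by
    [F] since [E(i^*W, i^!Z) = 0], by a quotient of [j_!j^*W], which has none
    since [E(j^*W, j^*Z) = 0]. The quotient is controlled by (iii), or is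
    [j_!j^*W] itself if [i^*] preserves conflations, as under (ii) and (v); for
    (v), [i_*] preserves projectives, hence injectives, and a right exact functor
    whose right adjoint preserves injectives preserves conflations
    ([left_adjoint_preserves_conflations]). Under (iv) either [W] comes from
    [j_!T2], or [Z] is an extension of [j_*j^*Z] by [i_*i^!Z] and both ends have
    no extensions from [W].

    Restriction. A cotorsion pair of the middle category has its approximations
    at [i_*X], resp. [j_*X], sent by [i^!], resp. [j^*], to
    approximations of [X]; the vanishing of extensions is transferred by the
    first mechanism. *)

(** * Preadditive categories *)

Lemma additive_0 (U V : zmodType) (h : U -> V) :
  (forall u v, h (u + v) = h u + h v) -> h 0 = 0.
Proof. by move=> hD; apply: (addrI (h 0)); rewrite -hD !addr0. Qed.

Lemma additive_N (U V : zmodType) (h : U -> V) :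
  (forall u v, h (u + v) = h u + h v) -> forall u, h (- u) = - h u.
Proof.
move=> hD u; apply: (addrI (h u)).
by rewrite -hD !subrr (additive_0 hD).
Qed.

Section Preadditive.
Variable C : PreaddCat.
Implicit Types X Y Z W : C.

Lemma comp0l X Y Z (f : Mor X Y) : (0 : Mor Y Z) ∘ f = 0.
Proof. exact: additive_0 (fun g g' => compDl g g' f). Qed.

Lemma comp0r X Y Z (g : Mor Y Z) : g ∘ (0 : Mor X Y) = 0.
Proof. exact: additive_0 (compDr g). Qed.

Lemma compBl X Y Z (g g' : Mor Y Z) (f : Mor X Y) :
  (g - g') ∘ f = g ∘ f - g' ∘ f.
Proof. by rewrite compDl (additive_N (fun u v => compDl u v f)). Qed.

Lemma compBr X Y Z (g : Mor Y Z) (f f' : Mor X Y) :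
  g ∘ (f - f') = g ∘ f - g ∘ f'.
Proof. by rewrite compDr (additive_N (compDr g)). Qed.

Lemma is_iso_id X : is_iso (idmor X).
Proof. by exists (idmor X); rewrite comp_idl. Qed.

Lemma is_iso_of_inverses X Y (f : Mor X Y) (l r : Mor Y X) :
  l ∘ f = idmor X -> f ∘ r = idmor Y -> is_iso f.
Proof.
move=> lf fr; exists l; split=> //.
have -> : l = r by rewrite -[l]comp_idr -fr comp_assoc lf comp_idl.
exact: fr.
Qed.

Lemma is_iso_inv X Y (f : Mor X Y) :
  is_iso f -> exists2 g : Mor Y X, is_iso g & g ∘ f = idmor X /\ f ∘ g = idmor Y.
Proof. by case=> g [gf fg]; exists g => //; exists f. Qed.

Lemma is_iso_comp X Y Z (g : Mor Y Z) (f : Mor X Y) :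
  is_iso g -> is_iso f -> is_iso (g ∘ f).
Proof.
case=> g' [g'g gg'] [f' [f'f ff']]; exists (f' ∘ g'); split.
  by rewrite comp_assoc -(comp_assoc f') g'g comp_idr.
by rewrite comp_assoc -(comp_assoc g) ff' comp_idr.
Qed.

Lemma is_iso_cancel_l X Y Z (g : Mor Y Z) (f : Mor X Y) :
  is_iso g -> is_iso (g ∘ f) -> is_iso f.
Proof.
move=> /is_iso_inv[g' g'i [g'g _]] gfi.
by rewrite -[f]comp_idl -g'g -comp_assoc; exact: is_iso_comp.
Qed.

Lemma is_iso_cancel_r X Y Z (g : Mor Y Z) (f : Mor X Y) :
  is_iso f -> is_iso (g ∘ f) -> is_iso g.
Proof.
move=> /is_iso_inv[f' f'i [_ ff']] gfi.
by rewrite -[g]comp_idr -ff' comp_assoc; exact: is_iso_comp.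
Qed.

Lemma isomorphic_of X Y (f : Mor X Y) : is_iso f -> isomorphic X Y.
Proof. by exists f. Qed.

Lemma isomorphic_sym X Y : isomorphic X Y -> isomorphic Y X.
Proof. by case=> f /is_iso_inv[g gi _]; exists g. Qed.

Lemma isomorphic_trans X Y Z :
  isomorphic X Y -> isomorphic Y Z -> isomorphic X Z.
Proof. by case=> f fi [g gi]; exists (g ∘ f); exact: is_iso_comp. Qed.

Lemma zero_obj_to Z (Zz : is_zero_object Z) X (f : Mor X Z) : f = 0.
Proof. by case: (Zz X). Qed.

Lemma zero_obj_from Z (Zz : is_zero_object Z) X (f : Mor Z X) : f = 0.
Proof. by case: (Zz X). Qed.

Lemma zero_obj_id Z : idmor Z = 0 -> is_zero_object Z.
Proof.
move=> id0 X; split=> f; first by rewrite -[f]comp_idl id0 comp0l.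
by rewrite -[f]comp_idr id0 comp0r.
Qed.

Lemma zero_obj_isomorphic X Y :
  isomorphic X Y -> is_zero_object Y -> is_zero_object X.
Proof.
case=> f [g [gf _]] Yz; apply: zero_obj_id.
by rewrite -gf (zero_obj_to Yz f) comp0r.
Qed.

Lemma is_iso_zero X Y (f : Mor X Y) :
  is_zero_object X -> is_zero_object Y -> is_iso f.
Proof.
move=> Xz Yz; exists 0; split.
  by rewrite comp0l (zero_obj_from Xz (idmor X)).
by rewrite comp0r (zero_obj_from Yz (idmor Y)).
Qed.

End Preadditive.

Section AdditiveFunctors.
Variables (A B : AddCat) (F : AddFunctor A B).

Lemma fmor0 (X Y : A) : fmor F (0 : Mor X Y) = 0.
Proof. exact: additive_0 (fmorD F (X := X) (Y := Y)). Qed.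

Lemma fmor_iso (X Y : A) (f : Mor X Y) : is_iso f -> is_iso (fmor F f).
Proof.
by case=> g [gf fg]; exists (fmor F g); rewrite -!fmor_comp gf fg !fmor_id.
Qed.

Lemma isomorphic_fobj (X Y : A) : isomorphic X Y -> isomorphic (F X) (F Y).
Proof. by case=> f fi; exists (fmor F f); exact: fmor_iso. Qed.

Lemma zero_obj_fobj (X : A) : is_zero_object X -> is_zero_object (F X).
Proof.
move=> Xz; apply: zero_obj_id.
by rewrite -fmor_id (zero_obj_to Xz (idmor X)) fmor0.
Qed.

Lemma image_subcat_iso (P : A -> Prop) : is_subcategory (image_subcat F P).
Proof.
move=> X Y XY [Z [PZ XZ]]; exists Z; split=> //.
exact: isomorphic_trans (isomorphic_sym XY) XZ.
Qed.

Lemma image_subcat_fobj (P : A -> Prop) X : P X -> image_subcat F P (F X).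
Proof. by exists X; split=> //; exists (idmor (F X)); exact: is_iso_id. Qed.

End AdditiveFunctors.

Section Adjunctions.
Variables (A B : AddCat) (L : AddFunctor A B) (R : AddFunctor B A).
Variable adj : Adjunction L R.

Lemma adj_unit_iso : fully_faithful L -> forall X : A, is_iso (unit_ adj X).
Proof.
move=> ff X; have [h fK hK] := ff (R (L X)) X.
exists (h (counit adj (L X))); split.
  have [h' f'K _] := ff X X; apply: (can_inj f'K).
  by rewrite fmor_comp hK triangleL fmor_id.
by rewrite unit_nat hK triangleR.
Qed.

Lemma adj_counit_iso : fully_faithful R -> forall Y : B, is_iso (counit adj Y).
Proof.
move=> ff Y; have [h fK hK] := ff Y (L (R Y)).
exists (h (unit_ adj (R Y))); split.
  by rewrite -counit_nat hK triangleL.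
have [h' f'K _] := ff Y Y; apply: (can_inj f'K).
by rewrite fmor_comp hK triangleR fmor_id.
Qed.

Lemma adj_R_counit_iso :
  fully_faithful L -> forall Y : B, is_iso (fmor R (counit adj Y)).
Proof.
move=> ff Y; apply: (is_iso_cancel_r (adj_unit_iso ff (R Y))).
by rewrite triangleR; exact: is_iso_id.
Qed.

Lemma adj_L_unit_iso :
  fully_faithful R -> forall X : A, is_iso (fmor L (unit_ adj X)).
Proof.
move=> ff X; apply: (is_iso_cancel_l (adj_counit_iso ff (L X))).
by rewrite triangleL; exact: is_iso_id.
Qed.

Lemma adj_mor_to_R0 (X : A) (Y : B) (f : Mor X (R Y)) :
  is_zero_object (L X) -> f = 0.
Proof.
move=> LX0; rewrite -[f]comp_idl -(triangleR adj) -comp_assoc unit_nat.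
by rewrite (zero_obj_from LX0 (fmor L f)) fmor0 comp0l comp0r.
Qed.

Lemma adj_mor_from_L0 (X : A) (Y : B) (f : Mor (L X) Y) :
  is_zero_object (R Y) -> f = 0.
Proof.
move=> RY0; rewrite -[f]comp_idr -(triangleL adj) comp_assoc -counit_nat.
by rewrite (zero_obj_to RY0 (fmor R f)) fmor0 comp0r comp0l.
Qed.

(** Being the transpose of [s] along the adjunction, [s'] lifts the identity
    when [s] lifts the unit. *)
Lemma adj_transpose_section (X : A) (Y : B) (s : Mor X (R Y)) (y : Mor Y (L X)) :
  fmor R y ∘ s = unit_ adj X -> exists s' : Mor (L X) Y, y ∘ s' = idmor (L X).
Proof.
move=> ys; exists (counit adj Y ∘ fmor L s).
by rewrite comp_assoc -counit_nat -comp_assoc -fmor_comp ys triangleL.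
Qed.

Lemma adj_transpose_retraction (X : A) (Y : B) (r : Mor (L X) Y)
    (x : Mor (R Y) X) :
  r ∘ fmor L x = counit adj Y -> exists r' : Mor X (R Y), r' ∘ x = idmor (R Y).
Proof.
move=> rx; exists (fmor R r ∘ unit_ adj X).
by rewrite -comp_assoc unit_nat comp_assoc -fmor_comp rx triangleR.
Qed.

End Adjunctions.

(** * Exact sequences in extriangulated categories *)

Section Extriangulated.
Variable CC : ExtriCat.
Implicit Types A B C D W X Y Z : CC.

Let sr := real_real (sreal_additive CC).

Lemma push0 C A A' (a : Mor A A') : push a (0 : ext (EE CC) C A) = 0.
Proof. exact: additive_0 (pushD (b := EE CC) a). Qed.

Lemma pull0 C C' A (c : Mor C' C) : pull c (0 : ext (EE CC) C A) = 0.
Proof. exact: additive_0 (pullD (b := EE CC) c). Qed.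

Lemma push_0 C A A' (d : ext (EE CC) C A) : push (0 : Mor A A') d = 0.
Proof. exact: additive_0 (fun a a' => push_add a a' d). Qed.

Lemma pull_0 C C' A (d : ext (EE CC) C A) : pull (0 : Mor C' C) d = 0.
Proof. exact: additive_0 (fun c c' => pull_add c c' d). Qed.

Lemma push_iso_inj C A A' (a : Mor A A') (d : ext (EE CC) C A) :
  is_iso a -> push a d = 0 -> d = 0.
Proof.
case=> a' [a'a _] ad.
by rewrite -[d]push_id -a'a push_comp ad push0.
Qed.

Lemma pull_iso_inj C C' A (c : Mor C' C) (d : ext (EE CC) C A) :
  is_iso c -> pull c d = 0 -> d = 0.
Proof.
case=> c' [_ cc'] cd.
by rewrite -[d]pull_id -cc' pull_comp cd pull0.
Qed.

Lemma realizes_id_zero W Z :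
  is_zero_object Z -> realizes (0 : ext (EE CC) Z W) (idmor W) (0 : Mor W Z).
Proof.
move=> Zz; apply: (real_zero (sreal_additive CC) (i2 := 0) (p1 := idmor W)).
split; rewrite ?comp_idl ?comp0l ?addr0 //.
exact/esym/(zero_obj_from Zz).
Qed.

Lemma realizes_zero_id W Z :
  is_zero_object Z -> realizes (0 : ext (EE CC) W Z) (0 : Mor Z W) (idmor W).
Proof.
move=> Zz; apply: (real_zero (sreal_additive CC) (p1 := 0) (i2 := idmor W)).
split; rewrite ?comp_idl ?comp0l ?add0r //.
exact/esym/(zero_obj_from Zz).
Qed.

(** The exactness statements below come from comparing an E-triangle with the
    trivial ones [W = W -> 0] and [0 -> W = W], by a morphism of extensions or
    by (ET3) and its dual. *)
Section ETriangleExactness.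
Variables (A B C : CC) (d : ext (EE CC) C A) (x : Mor A B) (y : Mor B C).
Hypothesis dxy : realizes d x y.

Lemma realizes_comp0 : y ∘ x = 0.
Proof.
have [Z Zz] := has_zero CC.
have e : push (idmor A) (0 : ext (EE CC) Z A) = pull (0 : Mor Z C) d.
  by rewrite push0 pull_0.
have [b] := real_morphism sr e (realizes_id_zero A Zz) dxy.
by rewrite !comp_idr comp0l => -[->].
Qed.

Lemma realizes_push0 : push x d = 0.
Proof.
have [Z Zz] := has_zero CC.
have [c []] := ET3 dxy (realizes_id_zero B Zz) (erefl (idmor B ∘ x)).
by rewrite pull0.
Qed.

Lemma realizes_pull0 : pull y d = 0.
Proof.
have [Z Zz] := has_zero CC.
have [a []] := ET3op (realizes_zero_id B Zz) dxy (erefl (y ∘ idmor B)).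
by rewrite push0 => ->.
Qed.

Lemma lift_pull0 W (c : Mor W C) :
  pull c d = 0 -> exists b : Mor W B, y ∘ b = c.
Proof.
have [Z Zz] := has_zero CC => cd0.
have e : push (0 : Mor Z A) (0 : ext (EE CC) W Z) = pull c d by rewrite push0.
have [b [_ yb]] := real_morphism sr e (realizes_zero_id W Zz) dxy.
by exists b; rewrite yb comp_idr.
Qed.

Lemma extend_push0 W (a : Mor A W) :
  push a d = 0 -> exists b : Mor B W, b ∘ x = a.
Proof.
have [Z Zz] := has_zero CC => ad0.
have e : push a d = pull (0 : Mor C Z) (0 : ext (EE CC) Z W) by rewrite pull0.
have [b [bx _]] := real_morphism sr e dxy (realizes_id_zero W Zz).
by exists b; rewrite bx comp_idl.
Qed.

Lemma factor_infl W (w : Mor W B) :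
  y ∘ w = 0 -> exists u : Mor W A, w = x ∘ u.
Proof.
have [Z Zz] := has_zero CC => yw.
have e : y ∘ w = (0 : Mor Z C) ∘ (0 : Mor W Z) by rewrite comp0l.
have [u [_ wu]] := ET3op (realizes_id_zero W Zz) dxy e.
by exists u; rewrite -wu comp_idr.
Qed.

Lemma factor_defl W (w : Mor B W) :
  w ∘ x = 0 -> exists u : Mor C W, w = u ∘ y.
Proof.
have [Z Zz] := has_zero CC => wx.
have e : w ∘ x = (0 : Mor Z W) ∘ (0 : Mor A Z) by rewrite comp0l.
have [u [_ wu]] := ET3 dxy (realizes_zero_id W Zz) e.
by exists u; rewrite -wu comp_idl.
Qed.

Lemma ext_defl_kernel W (e : ext (EE CC) C W) :
  pull y e = 0 -> exists a : Mor A W, e = push a d.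
Proof.
have [E [p [q epq]]] := real_nonempty sr e => ye0.
have [Z Zz] := has_zero CC.
have e0 : push (0 : Mor Z W) (0 : ext (EE CC) B Z) = pull y e by rewrite push0.
have [b [_ qb]] := real_morphism sr e0 (realizes_zero_id B Zz) epq.
have qb' : q ∘ b = idmor C ∘ y by rewrite qb comp_idr comp_idl.
have [a [ad _]] := ET3op dxy epq qb'.
by exists a; rewrite ad pull_id.
Qed.

(** Exactness at the middle term of [E(W,A) -> E(W,B) -> E(W,C)]: the
    octahedron on [x] and an inflation realizing [e] has [push y e], which is
    split, as its third E-triangle. *)
Lemma ext_middle_push W (e : ext (EE CC) W B) :
  push y e = 0 -> exists e' : ext (EE CC) W A, e = push x e'.
Proof.
have [E [p [q epq]]] := real_nonempty sr e => ye0.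
have [D [d3 [_ [_ [f [g [_ [_ [fg _ xd3]]]]]]]]] := ET4 dxy epq.
rewrite ye0 in fg.
have [s gs] : exists s : Mor W D, g ∘ s = idmor W.
  have [Z Zz] := has_zero CC.
  have e0 : push (0 : Mor Z C) (0 : ext (EE CC) W Z)
          = pull (idmor W) (0 : ext (EE CC) W C) by rewrite push0 pull0.
  have [s [_ gs]] := real_morphism sr e0 (realizes_zero_id W Zz) fg.
  by exists s; rewrite gs comp_idl.
exists (pull s d3).
by rewrite push_pull xd3 -pull_comp gs pull_id.
Qed.

Lemma ext_middle_pull W (e : ext (EE CC) B W) :
  pull x e = 0 -> exists e' : ext (EE CC) C W, e = pull y e'.
Proof.
have [E [p [q epq]]] := real_nonempty sr e => xe0.
have [D [d3 [_ [_ [f [g [_ [_ [gf _ yd3]]]]]]]]] := ET4op dxy epq.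
rewrite xe0 in gf.
have [r rg] : exists r : Mor D W, r ∘ g = idmor W.
  have [Z Zz] := has_zero CC.
  have e0 : push (idmor W) (0 : ext (EE CC) A W)
          = pull (0 : Mor A Z) (0 : ext (EE CC) Z W) by rewrite push0 pull0.
  have [r [rg _]] := real_morphism sr e0 gf (realizes_id_zero W Zz).
  by exists r; rewrite rg comp_idl.
exists (push r d3).
by rewrite -push_pull yd3 -push_comp rg push_id.
Qed.

End ETriangleExactness.

Lemma ext_vanishes_middle_r A B C W (x : Mor A B) (y : Mor B C) :
  conflation x y ->
  (forall e : ext (EE CC) W A, e = 0) -> (forall e : ext (EE CC) W C, e = 0) ->
  forall e : ext (EE CC) W B, e = 0.
Proof.
case=> d dxy WA WC e; have [e' ->] := ext_middle_push dxy (WC (push y e)).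
by rewrite (WA e') push0.
Qed.

Lemma ext_vanishes_middle_l A B C W (x : Mor A B) (y : Mor B C) :
  conflation x y ->
  (forall e : ext (EE CC) A W, e = 0) -> (forall e : ext (EE CC) C W, e = 0) ->
  forall e : ext (EE CC) B W, e = 0.
Proof.
case=> d dxy AW CW e; have [e' ->] := ext_middle_pull dxy (AW (pull x e)).
by rewrite (CW e') pull0.
Qed.

(** A piece of the long exact sequence
    [Hom(B,W) -> Hom(A,W) -> E(C,W) -> E(B,W)]. *)
Lemma ext_vanishes_cokernel A B C W (x : Mor A B) (y : Mor B C) :
  conflation x y ->
  (forall a : Mor A W, exists b : Mor B W, b ∘ x = a) ->
  (forall e : ext (EE CC) B W, e = 0) -> forall e : ext (EE CC) C W, e = 0.
Proof.
case=> d dxy AW BW e; have [a ->] := ext_defl_kernel dxy (BW (pull y e)).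
have [b <-] := AW a; by rewrite push_comp (realizes_push0 dxy) push0.
Qed.

Lemma ext_isomorphic_l X X' Y : isomorphic X X' ->
  (forall e : ext (EE CC) X' Y, e = 0) -> forall e : ext (EE CC) X Y, e = 0.
Proof.
case=> f [g [gf _]] X'Y e.
by rewrite -[e]pull_id -gf pull_comp (X'Y (pull g e)) pull0.
Qed.

Lemma ext_isomorphic_r X Y Y' : isomorphic Y Y' ->
  (forall e : ext (EE CC) X Y', e = 0) -> forall e : ext (EE CC) X Y, e = 0.
Proof.
case=> f [g [gf _]] XY' e.
by rewrite -[e]push_id -gf push_comp (XY' (push f e)) push0.
Qed.

(** The five lemma. Exactness makes [b] a split epimorphism because [c] is onto
    on Hom-groups and [a] is injective on extension groups, and dually a split
    monomorphism. *)
Lemma five_lemma A B C A' B' C' (d : ext (EE CC) C A) (d' : ext (EE CC) C' A')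
    (x : Mor A B) (y : Mor B C) (x' : Mor A' B') (y' : Mor B' C')
    (a : Mor A A') (b : Mor B B') (c : Mor C C') :
  realizes d x y -> realizes d' x' y' -> push a d = pull c d' ->
  b ∘ x = x' ∘ a -> y' ∘ b = c ∘ y -> is_iso a -> is_iso c -> is_iso b.
Proof.
move=> dxy dxy' adcd' bx yb ai ci.
have [a' a'i [a'a aa']] := is_iso_inv ai.
have [c' c'i [c'c cc']] := is_iso_inv ci.
have [r br] : exists r, b ∘ r = idmor B'.
  have [|v yv] := lift_pull0 dxy (c := c' ∘ y').
    apply: (push_iso_inj ai); rewrite push_pull adcd' -pull_comp comp_assoc cc'.
    by rewrite comp_idl (realizes_pull0 dxy').
  have [|u eu] := factor_infl dxy' (w := idmor B' - b ∘ v).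
    by rewrite compBr comp_idr comp_assoc yb -comp_assoc yv comp_assoc cc'
       comp_idl subrr.
  exists (v + x ∘ a' ∘ u).
  rewrite compDr 2!comp_assoc bx -(comp_assoc x') aa' comp_idr -eu.
  by rewrite addrC subrK.
have [l lb] : exists l, l ∘ b = idmor B.
  have [|v vx] := extend_push0 dxy' (a := x ∘ a').
    apply: (pull_iso_inj ci); rewrite -push_pull -adcd' -push_comp -comp_assoc.
    by rewrite a'a comp_idr (realizes_push0 dxy).
  have [|u eu] := factor_defl dxy (w := idmor B - v ∘ b).
    by rewrite compBl comp_idl -comp_assoc bx comp_assoc vx -comp_assoc a'a
       comp_idr subrr.
  exists (v + u ∘ c' ∘ y').
  rewrite compDl -2!comp_assoc yb (comp_assoc c') c'c comp_idl -eu.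
  by rewrite addrC subrK.
exact: is_iso_of_inverses lb br.
Qed.

Lemma middle_isomorphic A B C A' B' C' (d : ext (EE CC) C A)
    (d' : ext (EE CC) C' A') (x : Mor A B) (y : Mor B C) (x' : Mor A' B')
    (y' : Mor B' C') (a : Mor A A') (c : Mor C C') :
  realizes d x y -> realizes d' x' y' -> push a d = pull c d' ->
  is_iso a -> is_iso c -> isomorphic B B'.
Proof.
move=> dxy dxy' e ai ci; have [b [bx yb]] := real_morphism sr e dxy dxy'.
by exists b; exact: five_lemma dxy dxy' e bx yb ai ci.
Qed.

Lemma conflation_iso_r A B C C' (x : Mor A B) (y : Mor B C) (c : Mor C C') :
  conflation x y -> is_iso c -> conflation x (c ∘ y).
Proof.
case=> d dxy ci; have [c' c'i [c'c cc']] := is_iso_inv ci.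
exists (pull c' d).
have [E [p [q dpq]]] := real_nonempty sr (pull c' d).
have e : push (idmor A) d = pull c (pull c' d).
  by rewrite push_id -pull_comp c'c pull_id.
have [b [bx qb]] := real_morphism sr e dxy dpq.
have [b' b'i [b'b bb']] :=
  is_iso_inv (five_lemma dxy dpq e bx qb (is_iso_id A) ci).
apply/(real_class sr _ _ dpq); exists b'; split=> //.
  by rewrite -[p]comp_idr -bx comp_assoc b'b comp_idl.
by rewrite -qb -comp_assoc bb' comp_idr.
Qed.

Lemma conflation_iso_l A A' B C (x : Mor A B) (y : Mor B C) (a : Mor A' A) :
  conflation x y -> is_iso a -> conflation (x ∘ a) y.
Proof.
case=> d dxy ai; have [a' a'i [a'a aa']] := is_iso_inv ai.
exists (push a' d).
have [E [p [q dpq]]] := real_nonempty sr (push a' d).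
have e : push a' d = pull (idmor C) (push a' d) by rewrite pull_id.
have [b [bx qb]] := real_morphism sr e dxy dpq.
have [b' b'i [b'b bb']] :=
  is_iso_inv (five_lemma dxy dpq e bx qb a'i (is_iso_id C)).
apply/(real_class sr _ _ dpq); exists b'; split=> //.
  rewrite -[p]comp_idr -a'a (comp_assoc p) -bx (comp_assoc b') (comp_assoc b').
  by rewrite b'b comp_idl.
by rewrite -[RHS]comp_idr -bb' (comp_assoc q) qb comp_idl.
Qed.

Lemma conflation_iso_mid A B B' C (x : Mor A B) (y : Mor B C) (b : Mor B B')
    (b' : Mor B' B) :
  conflation x y -> b' ∘ b = idmor B -> b ∘ b' = idmor B' ->
  conflation (b ∘ x) (y ∘ b').
Proof.
case=> d dxy b'b bb'; exists d; apply/(real_class sr _ _ dxy).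
by exists b; split=> //; [exists b' | rewrite -comp_assoc b'b comp_idr].
Qed.

Lemma conflation_zero_r A B C (x : Mor A B) (y : Mor B C) :
  conflation x y -> is_zero_object C -> is_iso x.
Proof.
case=> d dxy Cz.
have d0 : d = 0 by rewrite -[d]pull_id (zero_obj_to Cz (idmor C)) pull_0.
have [|l lx] := extend_push0 dxy (a := idmor A); first by rewrite push_id.
have [|r xr] := factor_infl dxy (w := idmor B); first exact: zero_obj_to.
exact: is_iso_of_inverses lx (esym xr).
Qed.

Lemma conflation_zero_l A B C (x : Mor A B) (y : Mor B C) :
  conflation x y -> is_zero_object A -> is_iso y.
Proof.
case=> d dxy Az.
have d0 : d = 0 by rewrite -[d]push_id (zero_obj_to Az (idmor A)) push_0.
have [|r yr] := lift_pull0 dxy (c := idmor C); first by rewrite pull_id.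
have [|l ly] := factor_defl dxy (w := idmor B); first exact: zero_obj_from.
exact: is_iso_of_inverses (esym ly) yr.
Qed.

Lemma conflation_infl_iso A B C (x : Mor A B) (y : Mor B C) :
  conflation x y -> is_iso x -> is_zero_object C.
Proof.
case=> d dxy xi; have d0 := push_iso_inj xi (realizes_push0 dxy).
have [|r yr] := lift_pull0 dxy (c := idmor C); first by rewrite pull_id.
have [x' [_ xx']] := xi; apply: zero_obj_id; rewrite -yr.
by rewrite -[y]comp_idr -xx' comp_assoc (realizes_comp0 dxy) !comp0l.
Qed.

Lemma conflation_defl_iso A B C (x : Mor A B) (y : Mor B C) :
  conflation x y -> is_iso y -> is_zero_object A.
Proof.
case=> d dxy yi; have d0 := pull_iso_inj yi (realizes_pull0 dxy).
have [|l lx] := extend_push0 dxy (a := idmor A); first by rewrite push_id.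
have [y' [y'y _]] := yi; apply: zero_obj_id; rewrite -lx.
by rewrite -[x]comp_idl -y'y -comp_assoc (realizes_comp0 dxy) !comp0r.
Qed.

Lemma inflation_iso A B (f : Mor A B) : is_iso f -> inflation f.
Proof.
move=> fi; have [Z Zz] := has_zero CC; have [f' f'i [f'f ff']] := is_iso_inv fi.
exists Z, (0 ∘ f'); rewrite -[f]comp_idr; apply: (conflation_iso_mid _ f'f ff').
by exists 0; exact: realizes_id_zero.
Qed.

(** Compatibility excludes the deflations [0 -> X] with [X] nonzero, which are
    present in a triangulated category. *)
Lemma compatible_defl_zero X Y (f : Mor X Y) :
  is_zero_object X -> deflation f -> compatible f -> is_zero_object Y.
Proof.
move=> Xz df cf; apply: (zero_obj_isomorphic _ Xz).
apply/isomorphic_sym/isomorphic_of/cf; split=> //.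
exists Y, (idmor Y), 0; rewrite (zero_obj_from Xz f); exact: realizes_zero_id.
Qed.

End Extriangulated.

(** * Functors and extensions *)

Definition preserves_conflations (A B : ExtriCat) (F : AddFunctor A B) : Prop :=
  forall (X Y Z : A) (x : Mor X Y) (y : Mor Y Z),
    conflation x y -> conflation (fmor F x) (fmor F y).

Lemma exact_preserves_conflations (A B : ExtriCat) (F : AddFunctor A B) :
  exact_functor F -> preserves_conflations F.
Proof.
by case=> _ [eta [_ _ _ etaR]] X Y Z x y [d dxy]; exists (eta Z X d); exact: etaR.
Qed.

(** Pushing out along a morphism that [F] inverts does not change the image of
    the middle term: the morphism of extensions given by the pushout becomes one
    with invertible ends, to which the five lemma applies. *)
Lemma exact_pushout_middle (A B : ExtriCat) (F : AddFunctor A B)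
    (X Y Z X' Y' : A) (d : ext (EE A) Z X) (x : Mor X Y) (y : Mor Y Z)
    (a : Mor X X') (x' : Mor X' Y') (y' : Mor Y' Z) :
  exact_functor F -> realizes d x y -> realizes (push a d) x' y' ->
  is_iso (fmor F a) -> isomorphic (F Y) (F Y').
Proof.
case=> _ [eta [_ eta_push _ etaR]] dxy dxy' ai.
apply: (middle_isomorphic (etaR _ _ _ _ _ _ dxy) (etaR _ _ _ _ _ _ dxy')
  (a := fmor F a) (c := idmor _)) => //; last exact: is_iso_id.
by rewrite eta_push pull_id.
Qed.

Lemma exact_pullback_middle (A B : ExtriCat) (F : AddFunctor A B)
    (X Y Z Y' Z' : A) (d : ext (EE A) Z X) (x : Mor X Y) (y : Mor Y Z)
    (c : Mor Z' Z) (x' : Mor X Y') (y' : Mor Y' Z') :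
  exact_functor F -> realizes d x y -> realizes (pull c d) x' y' ->
  is_iso (fmor F c) -> isomorphic (F Y') (F Y).
Proof.
case=> _ [eta [_ _ eta_pull etaR]] dxy dxy' ci.
apply: (middle_isomorphic (etaR _ _ _ _ _ _ dxy') (etaR _ _ _ _ _ _ dxy)
  (a := idmor _) (c := fmor F c)) => //; last exact: is_iso_id.
by rewrite eta_pull push_id.
Qed.

Section AdjunctionExtensions.
Variables (A B : ExtriCat) (L : AddFunctor A B) (R : AddFunctor B A).
Variable adj : Adjunction L R.

(** An extension of [L X] by [Y] splits as soon as its image under [R], pulled
    back along the unit, does: the transpose of a lifting of the unit is a
    section. *)
Lemma ext_vanishes_L (X : A) (Y : B) : preserves_conflations R ->
  (forall e : ext (EE A) X (R Y), e = 0) -> forall e : ext (EE B) (L X) Y, e = 0.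
Proof.
move=> Rc XRY e; have [E [p [q epq]]] := real_nonempty (real_real (sreal_additive B)) e.
have [d dpq] : conflation (fmor R p) (fmor R q) by apply: Rc; exists e.
have [s qs] := lift_pull0 dpq (XRY (pull (unit_ adj X) d)).
have [s' qs'] := adj_transpose_section qs.
by rewrite -[e]pull_id -qs' pull_comp (realizes_pull0 epq) pull0.
Qed.

Lemma ext_vanishes_R (X : A) (Y : B) : preserves_conflations L ->
  (forall e : ext (EE B) (L X) Y, e = 0) -> forall e : ext (EE A) X (R Y), e = 0.
Proof.
move=> Lc LXY e; have [E [p [q epq]]] := real_nonempty (real_real (sreal_additive A)) e.
have [d dpq] : conflation (fmor L p) (fmor L q) by apply: Lc; exists e.
have [r rp] := extend_push0 dpq (LXY (push (counit adj Y) d)).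
have [r' rp'] := adj_transpose_retraction rp.
by rewrite -[e]push_id -rp' push_comp (realizes_push0 epq) push0.
Qed.

Lemma projective_L (P : A) :
  preserves_conflations R -> projective P -> projective (L P).
Proof.
move=> Rc projP X Y Z x y xy c.
have [b yb] := projP _ _ _ _ _ (Rc _ _ _ _ _ xy) (fmor R c ∘ unit_ adj P).
exists (counit adj Y ∘ fmor L b).
rewrite comp_assoc -counit_nat -comp_assoc -fmor_comp yb fmor_comp comp_assoc.
by rewrite counit_nat -comp_assoc triangleL comp_idr.
Qed.

(** A right exact left adjoint fails to preserve a conflation only through the
    compatible deflation [L X -> X'] onto the kernel. If [R] preserves
    injectives, an inflation of [L X] into an injective [I] extends, after
    transposition, over [L Y], hence factors through that deflation, which is
    then also an inflation. *)
Lemma left_adjoint_preserves_conflations :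
  WIC B -> right_exact_functor L -> enough_injectives B ->
  (forall I : B, injective_obj I -> injective_obj (R I)) ->
  preserves_conflations L.
Proof.
move=> wicB [_ _ [im _]] injB RI X Y Z x y [d dxy].
have [K k h e dh ch xE kR] := im (Build_ETriangle dxy).
rewrite /= in k h e dh ch xE kR.
have [I [Q [u [v [uv Iinj]]]]] := injB (L X).
have cxy : conflation x y by exists d.
have [b bx] := RI I Iinj _ _ _ _ _ cxy (fmor R u ∘ unit_ adj X).
have uE : u = counit adj I ∘ fmor L b ∘ k ∘ h.
  rewrite -2!comp_assoc -xE -fmor_comp bx fmor_comp comp_assoc counit_nat.
  by rewrite -comp_assoc triangleL comp_idr.
have hi : is_iso h.
  apply: ch; split=> //; apply: (wicB.1 _ _ _ h (counit adj I ∘ fmor L b ∘ k)).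
  by rewrite -uE; exists Q, v.
by rewrite xE; apply: conflation_iso_l => //; exists e.
Qed.

End AdjunctionExtensions.

(** * Recollements *)

Section Recollement.
Variables (A B C : ExtriCat) (R : Recollement A B C).
Hypotheses (wicA : WIC A) (wicC : WIC C).
Hypothesis i_shr_exact : exact_functor (i_shr R).
Hypothesis j_shr_exact : exact_functor (j_shr R).

Let i_lowc := exact_preserves_conflations (i_low_exact R).
Let j_upc := exact_preserves_conflations (j_up_exact R).
Let i_shrc := exact_preserves_conflations i_shr_exact.
Let j_shrc := exact_preserves_conflations j_shr_exact.

Let i_unit := adj_unit_iso (adj_i_low_shr R) (@i_low_ff _ _ _ R).
Let i_counit := adj_counit_iso (adj_i_up_low R) (@i_low_ff _ _ _ R).
Let j_unit := adj_unit_iso (adj_j_shr_up R) (@j_shr_ff _ _ _ R).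
Let j_counit := adj_counit_iso (adj_j_up_low R) (@j_low_ff _ _ _ R).

Lemma i_shr_low_iso X : isomorphic (i_shr R (i_low R X)) X.
Proof. exact/isomorphic_sym/isomorphic_of/i_unit. Qed.

Lemma i_up_low_iso X : isomorphic (i_up R (i_low R X)) X.
Proof. exact/isomorphic_of/i_counit. Qed.

Lemma j_up_shr_iso X : isomorphic (j_up R (j_shr R X)) X.
Proof. exact/isomorphic_sym/isomorphic_of/j_unit. Qed.

Lemma j_up_low_iso X : isomorphic (j_up R (j_low R X)) X.
Proof. exact/isomorphic_of/j_counit. Qed.

Lemma j_up_i_low_zero X : is_zero_object (j_up R (i_low R X)).
Proof.
apply/im_i_ker_j; exists X; exact: isomorphic_of (is_iso_id _).
Qed.

Lemma i_shr_j_low_zero X : is_zero_object (i_shr R (j_low R X)).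
Proof.
apply: zero_obj_id; rewrite -(triangleR (adj_i_low_shr R)).
rewrite (adj_mor_to_R0 (adj_j_up_low R) (counit _ _)) ?fmor0 ?comp0l //.
exact: j_up_i_low_zero.
Qed.

Lemma i_up_j_shr_zero X : is_zero_object (i_up R (j_shr R X)).
Proof.
apply: zero_obj_id; rewrite -(triangleL (adj_i_up_low R)).
rewrite (adj_mor_from_L0 (adj_j_shr_up R) (unit_ _ _)) ?fmor0 ?comp0r //.
exact: j_up_i_low_zero.
Qed.

Lemma i_low_zero_reflect X : is_zero_object (i_up R (i_low R X)) ->
  is_zero_object (i_low R X).
Proof.
by move=> z; apply/zero_obj_fobj/(zero_obj_isomorphic _ z)/isomorphic_sym/i_up_low_iso.
Qed.

(** Exactness of [i^!] removes the error term [i_*A] of [rec_left]. The cokernel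
    [K] of the counit is killed by [i^!], which inverts the counit; applied to
    [K -> j_*j^*X -> i_*A], whose first two terms it kills, [i^!] then gives
    [A = 0]. *)
Lemma recollement_short_left (X : B) :
  conflation (counit (adj_i_low_shr R) X) (unit_ (adj_j_up_low R) X).
Proof.
have [Y [h [K [g1 [g2 [cg1 cg2 -> _]]]]]] := rec_left R X.
have Kz : is_zero_object (i_shr R K).
  exact: conflation_infl_iso (i_shrc cg1) (adj_R_counit_iso _ (@i_low_ff _ _ _ R) X).
have Yz : is_zero_object (i_low R Y).
  apply/zero_obj_fobj/(zero_obj_isomorphic (isomorphic_sym (i_shr_low_iso Y))).
  apply: (conflation_infl_iso (i_shrc cg2)).
  by apply: is_iso_zero => //; exact: i_shr_j_low_zero.
exact: conflation_iso_r cg1 (conflation_zero_r cg2 Yz).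
Qed.

(** The mirror image: [i^*] inverts the unit and kills [j_!], so it kills the
    error term of [rec_right] when it preserves conflations. *)
Lemma recollement_short_right (X : B) : preserves_conflations (i_up R) ->
  conflation (counit (adj_j_shr_up R) X) (unit_ (adj_i_up_low R) X).
Proof.
move=> i_upc; have [Y [h [K [g1 [g2 [cg1 cg2 -> _]]]]]] := rec_right R X.
have Kz : is_zero_object (i_up R K).
  exact: conflation_defl_iso (i_upc _ _ _ _ _ cg2)
    (adj_L_unit_iso _ (@i_low_ff _ _ _ R) X).
have Yz : is_zero_object (i_low R Y).
  apply: i_low_zero_reflect; apply: (conflation_defl_iso (i_upc _ _ _ _ _ cg1)).
  by apply: is_iso_zero => //; exact: i_up_j_shr_zero.
exact: conflation_iso_l cg2 (conflation_zero_l cg1 Yz).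
Qed.

(** Left exactness gives a conflation [j_*X -> j_*Y -> K] and a compatible
    inflation [l : K -> j_*Z]. By (WIC) the inflation [j^* l] is also a
    deflation, since composing it with [j^*j_*Y -> j^*K] gives the deflation
    [Y -> Z]; so [j^* l] is invertible. As [i^! K = 0], the unit at [K] is
    invertible, and [l] is identified with [j_*j^* l]. *)
Lemma j_low_preserves_conflations : preserves_conflations (j_low R).
Proof.
move=> X Y Z x y [d dxy]; have cxy : conflation x y by exists d.
have [_ _ [im _]] := j_low_lexact R.
have [K k l e il cl yE kR] := im (Build_ETriangle dxy).
rewrite /= in k l e il cl yE kR.
have ck : conflation (fmor (j_low R) x) k by exists e.
have Kz : is_zero_object (i_shr R K).
  apply: (conflation_infl_iso (i_shrc ck)).
  by apply: is_iso_zero; exact: i_shr_j_low_zero.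
have uK : is_iso (unit_ (adj_j_up_low R) K).
  apply: conflation_zero_l (recollement_short_left K) _; exact: zero_obj_fobj.
have uZ : is_iso (unit_ (adj_j_up_low R) (j_low R Z)).
  apply: (is_iso_cancel_l (fmor_iso (j_low R) (j_counit Z))).
  rewrite triangleR; exact: is_iso_id.
have jl : is_iso (fmor (j_up R) l).
  have [Q [q clq]] := il.
  have [pres_compat _] := j_up_exact R.
  apply: pres_compat => //; split.
    by exists (j_up R Q), (fmor (j_up R) q); exact: j_upc.
  have [c [cc cc']] := j_counit Y; have [c2 c2i [cc2 cc2']] := is_iso_inv (j_counit Z).
  have [P [p cp]] : deflation (counit (adj_j_up_low R) Z ∘ fmor (j_up R) l).
    apply: (wicC.2 _ _ _ (fmor (j_up R) k)).
    rewrite -comp_assoc -fmor_comp -yE counit_nat.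
    by exists X, (c ∘ x); exact: conflation_iso_mid.
  exists P, p; rewrite -[fmor _ l]comp_idl -cc2 -comp_assoc.
  exact: conflation_iso_r.
have li : is_iso l.
  apply: (is_iso_cancel_l uZ); rewrite unit_nat.
  by apply: is_iso_comp => //; exact: fmor_iso.
by rewrite yE; exact: conflation_iso_r.
Qed.

(** What [exact_pullback_middle] gives for an exact functor, for the merely right
    exact [i^*] and the unit [Y -> i_*i^*Y]. The image of each of the two
    E-triangles starts with a compatible deflation [h : i^*i_*X -> K], and it
    suffices that both are invertible. For the E-triangle on [i_*T] it is, since
    [i^*i_*x], which is [x] up to isomorphism, is an inflation that has [h] as
    its first factor, so that (WIC) makes [h] an inflation. For the pulled back
    E-triangle, naturality makes [h] the first factor of the previous
    isomorphism, and (WIC) applies again. *)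
Lemma i_up_pullback_middle (X T : A) (Y Z : B) (x : Mor X T)
    (y : Mor T (i_up R Y)) (d : ext (EE B) (i_low R (i_up R Y)) (i_low R X))
    (z : Mor (i_low R X) Z) (w : Mor Z Y) :
  conflation x y -> realizes d (fmor (i_low R) x) (fmor (i_low R) y) ->
  realizes (pull (unit_ (adj_i_up_low R) Y) d) z w ->
  isomorphic (i_up R Z) T.
Proof.
move=> cxy dxy dzw; have [_ _ [im im_nat]] := i_up_rexact R.
have [|a' [a'E a'eta]] := im_nat (Build_ETriangle dzw) (Build_ETriangle dxy)
  (idmor _) (unit_ (adj_i_up_low R) Y); first by rewrite push_id.
case: (im (Build_ETriangle dzw)) a' a'E a'eta => /= K1 k1 h1 e1 dh1 ch1 _ R1 a'.
case: (im (Build_ETriangle dxy)) a' => /= K2 k2 h2 e2 dh2 ch2 E2 R2 a'.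
rewrite fmor_id comp_idr => a'E a'eta.
have h2i : is_iso h2.
  apply: ch2; split=> //; apply: (wicA.1 _ _ _ h2 (counit (adj_i_up_low R) T ∘ k2)).
  rewrite -comp_assoc -E2 counit_nat.
  have [c [cc cc']] := i_counit X.
  exists (i_up R Y), y; exact: conflation_iso_l.
have h1i : is_iso h1.
  apply: ch1; split=> //; apply: (wicA.1 _ _ _ h1 a').
  by rewrite a'E; exact: inflation_iso.
have a'i : is_iso a' by apply: (is_iso_cancel_r h1i); rewrite a'E.
apply: isomorphic_trans (i_up_low_iso T).
apply: (middle_isomorphic R1 R2 a'eta a'i).
exact: adj_L_unit_iso (@i_low_ff _ _ _ R) Y.
Qed.

(** * Cotorsion pairs and recollements *)

Section Gluing.
Variables (T1 F1 : A -> Prop) (T2 F2 : C -> Prop).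
Hypotheses (cot1 : cotorsion_pair T1 F1) (cot2 : cotorsion_pair T2 F2).
Let T := glued_T R T1 T2.
Let F := glued_F R F1 F2.

Lemma glued_T_subcategory : is_subcategory T.
Proof.
case: cot1 cot2 => [sT1 _ _ _ _] [sT2 _ _ _ _] X Y XY [TX1 TX2]; split.
  by apply: sT1 TX1; exact: isomorphic_fobj.
by apply: sT2 TX2; exact: isomorphic_fobj.
Qed.

Lemma glued_F_subcategory : is_subcategory F.
Proof.
case: cot1 cot2 => [_ sF1 _ _ _] [_ sF2 _ _ _] X Y XY [FX1 FX2]; split.
  by apply: sF1 FX1; exact: isomorphic_fobj.
by apply: sF2 FX2; exact: isomorphic_fobj.
Qed.

(** First correct [j^*X] and then [i^!Y], by pushing out along the counits of
    [(j_!, j^* )] and [(i_*, i^!)]. By (ET4) the composite [X -> Y -> Z] is an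
    inflation whose cokernel [W] is an extension of [i_*T1] by [j_!T2]. *)
Lemma glued_coapproximation (X : B) :
  exists (Z W : B) (x : Mor X Z) (y : Mor Z W),
    [/\ conflation x y, F Z & T W].
Proof.
case: cot1 cot2 => [sT1 sF1 _ _ app1] [sT2 sF2 _ _ app2].
have sr := real_real (sreal_additive B).
have [P2 [Q2 [p2 [q2 [pq2 FP2 TQ2]]]]] := app2 (j_up R X).
have [d2 dR2] := j_shrc pq2.
have [Y [f [f' dY]]] := real_nonempty sr (push (counit (adj_j_shr_up R) X) d2).
have FY : F2 (j_up R Y).
  apply: sF2 FP2.
  apply: isomorphic_trans (isomorphic_sym (j_up_shr_iso P2)) _.
  apply: exact_pushout_middle (j_up_exact R) dR2 dY _.
  exact: adj_R_counit_iso (@j_shr_ff _ _ _ R) X.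
have [P1 [Q1 [p1 [q1 [pq1 FP1 TQ1]]]]] := app1 (i_shr R Y).
have [d1 dR1] := i_lowc pq1.
have [Z [g [g' dZ]]] := real_nonempty sr (push (counit (adj_i_low_shr R) Y) d1).
have cZ : conflation g g' by exists (push (counit (adj_i_low_shr R) Y) d1).
have [W [d3 [h [h' [d [e [hR [_ [deR _ _]]]]]]]]] := ET4 dY dZ.
have cW : conflation d e by exists (push f' (push (counit (adj_i_low_shr R) Y) d1)).
exists Z, W, h, h'; split; first by exists d3.
- split.
    apply: sF1 FP1.
    apply: isomorphic_trans (isomorphic_sym (i_shr_low_iso P1)) _.
    apply: exact_pushout_middle i_shr_exact dR1 dZ _.
    exact: adj_R_counit_iso (@i_low_ff _ _ _ R) Y.
  apply: sF2 FY; apply/isomorphic_of/(conflation_zero_r (j_upc cZ)).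
  exact: j_up_i_low_zero.
- split; last first.
    apply: sT2 TQ2; apply: isomorphic_trans (isomorphic_sym (j_up_shr_iso Q2)) _.
    apply/isomorphic_of/(conflation_zero_r (j_upc cW)).
    exact: j_up_i_low_zero.
  have [_ _ [im _]] := i_up_rexact R.
  have [K k l eta dl cl _ kR] := im (Build_ETriangle deR).
  rewrite /= in k l eta dl cl kR.
  have Kz : is_zero_object K.
    exact: compatible_defl_zero (i_up_j_shr_zero Q2) dl cl.
  apply: sT1 TQ1; apply: isomorphic_sym.
  apply: isomorphic_trans (i_up_low_iso Q1); apply: isomorphic_of.
  by apply: conflation_zero_l Kz; exists eta; exact: kR.
Qed.

(** The construction is dual, with pullbacks along the units of [(j^*, j_* )] and
    [(i^*, i_* )], except that [i^*] is only right exact: its value at the second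
    pullback is given by [i_up_pullback_middle]. The roles of [j_!] and of its
    exactness are taken by [j_*] and [j_low_preserves_conflations]. Building both
    approximations directly avoids closure of the classes under direct summands,
    which the definition of cotorsion pairs does not include. *)
Lemma glued_approximation (X : B) :
  exists (W Z : B) (x : Mor W Z) (y : Mor Z X),
    [/\ conflation x y, F W & T Z].
Proof.
case: cot1 cot2 => [sT1 sF1 _ app1 _] [sT2 sF2 _ app2 _].
have sr := real_real (sreal_additive B).
have [P2 [Q2 [p2 [q2 [pq2 FP2 TQ2]]]]] := app2 (j_up R X).
have [d2 dR2] := j_low_preserves_conflations pq2.
have [Y [f' [f dY]]] := real_nonempty sr (pull (unit_ (adj_j_up_low R) X) d2).
have TY : T2 (j_up R Y).
  apply: sT2 TQ2; apply: isomorphic_sym.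
  apply: isomorphic_trans (j_up_low_iso Q2).
  apply: exact_pullback_middle (j_up_exact R) dR2 dY _.
  exact: adj_L_unit_iso (@j_low_ff _ _ _ R) X.
have [P1 [Q1 [p1 [q1 [pq1 FP1 TQ1]]]]] := app1 (i_up R Y).
have [d1 dR1] := i_lowc pq1.
have [Z [g' [g dZ]]] := real_nonempty sr (pull (unit_ (adj_i_up_low R) Y) d1).
have cZ : conflation g' g by exists (pull (unit_ (adj_i_up_low R) Y) d1).
have [W [d3 [h' [h [d [e [hR [_ [deR _ _]]]]]]]]] := ET4op dY dZ.
have cW : conflation e d by exists (pull f' (pull (unit_ (adj_i_up_low R) Y) d1)).
exists W, Z, h', h; split; first by exists d3.
- split.
    apply: sF1 FP1; apply: isomorphic_trans (isomorphic_sym (i_shr_low_iso P1)) _.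
    apply/isomorphic_of/(conflation_zero_r (i_shrc cW)).
    exact: i_shr_j_low_zero.
  apply: sF2 FP2; apply: isomorphic_sym; apply: isomorphic_trans (j_up_low_iso P2).
  apply/isomorphic_of/(conflation_zero_l (j_upc cW)).
  exact: j_up_i_low_zero.
- split.
    apply: sT1 TQ1; apply: isomorphic_sym.
    exact: i_up_pullback_middle pq1 dR1 dZ.
  apply: sT2 TY; apply/isomorphic_sym/isomorphic_of/(conflation_zero_l (j_upc cZ)).
  exact: j_up_i_low_zero.
Qed.

Lemma glued_cotorsion_pair : ext_vanishes T F -> cotorsion_pair T F.
Proof.
move=> TF; split=> //.
- exact: glued_T_subcategory.
- exact: glued_F_subcategory.
- exact: glued_approximation.
- exact: glued_coapproximation.
Qed.

Lemma ext_j_shr_vanishes (Y : C) (Z : B) : T2 Y -> F Z ->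
  forall e : ext (EE B) (j_shr R Y) Z, e = 0.
Proof.
case: cot2 => _ _ van2 _ _ TY [_ FZ].
by apply: (ext_vanishes_L (adj_j_shr_up R) j_upc); exact: van2.
Qed.

Lemma ext_i_low_up_vanishes (W Z : B) : T W -> F Z ->
  forall e : ext (EE B) (i_low R (i_up R W)) Z, e = 0.
Proof.
case: cot1 => _ _ van1 _ _ [TW _] [FZ _].
by apply: (ext_vanishes_L (adj_i_low_shr R) i_shrc); exact: van1.
Qed.

Lemma ext_vanishes_of_i_up : preserves_conflations (i_up R) -> ext_vanishes T F.
Proof.
move=> i_upc W Z TW FZ.
apply: (ext_vanishes_middle_l (recollement_short_right W i_upc)).
  by apply: ext_j_shr_vanishes => //; case: TW.
exact: ext_i_low_up_vanishes.
Qed.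

(** In [rec_right], [W] is an extension of [i_*i^*W] by the cokernel of a morphism
    [i_*A' -> j_!j^*W], whose extensions by [Z] vanish when the morphisms
    [i_*A' -> Z] extend to [j_!j^*W]. *)
Lemma ext_vanishes_of_extension :
  (forall (X : A) (Y : C), T2 Y -> forall f : Mor (i_low R X) (j_shr R Y),
     forall Z : B, F Z -> forall g : Mor (i_low R X) Z,
     exists h : Mor (j_shr R Y) Z, h ∘ f = g) ->
  ext_vanishes T F.
Proof.
move=> extend W Z TW FZ; have TW2 : T2 (j_up R W) by case: TW.
have [Y [h [K [g1 [g2 [cg1 cg2 _ _]]]]]] := rec_right R W.
apply: (ext_vanishes_middle_l cg2); last exact: ext_i_low_up_vanishes.
apply: (ext_vanishes_cokernel cg1); first exact: extend.
exact: ext_j_shr_vanishes.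
Qed.

Lemma ext_vanishes_of_T_in_j_shr :
  subcat_incl T (image_subcat (j_shr R) T2) -> ext_vanishes T F.
Proof.
move=> incl W Z TW FZ; have [Y [TY WY]] := incl W TW.
exact: ext_isomorphic_l WY (ext_j_shr_vanishes TY FZ).
Qed.

Lemma ext_vanishes_of_i_low_F1 :
  subcat_incl (image_subcat (i_low R) F1) (perp1 T) -> ext_vanishes T F.
Proof.
case: cot2 => _ _ van2 _ _ incl W Z TW FZ.
apply: (ext_vanishes_middle_r (recollement_short_left Z)).
  by apply: incl TW; apply: image_subcat_fobj; case: FZ.
apply: (ext_vanishes_R (adj_j_up_low R) j_upc); apply: van2.
  by case: TW.
by case: FZ.
Qed.

End Gluing.

(** [i_*] preserves projectives because [i^!] is exact, hence injectives because
    the two classes coincide on both sides. *)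
Lemma Frobenius_i_up_preserves_conflations :
  Frobenius A -> Frobenius B -> preserves_conflations (i_up R).
Proof.
move=> [_ injA pA] [_ _ pB].
apply: (left_adjoint_preserves_conflations (adj_i_up_low R)) => //.
  exact: i_up_rexact.
move=> I /pA Ip; apply/pB => X Y Z x y.
exact: (projective_L (adj_i_low_shr R) i_shrc Ip).
Qed.

Section Restriction.
Variables U V : B -> Prop.
Hypothesis cotUV : cotorsion_pair U V.

Lemma restricted_cotorsion_pair_A :
  subcat_incl (image_subcat (i_low R) (image_subcat (i_shr R) U)) U ->
  subcat_incl (image_subcat (i_low R) (image_subcat (i_up R) U)) U ->
  cotorsion_pair (image_subcat (i_up R) U) (image_subcat (i_shr R) V).
Proof.
case: cotUV => sU sV van app coapp i_shrU i_upU.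
have shr_up Q : U Q -> image_subcat (i_up R) U (i_shr R Q).
  move=> UQ; exists (i_low R (i_shr R Q)); split.
    by apply: i_shrU; do 2!apply: image_subcat_fobj.
  exact/isomorphic_sym/i_up_low_iso.
split; try exact: image_subcat_iso.
- move=> X Y [P [UP XP]] [Q [VQ YQ]].
  apply: (ext_isomorphic_l XP); apply: (ext_isomorphic_r YQ).
  apply: (ext_vanishes_R (adj_i_low_shr R) i_lowc); apply: van => //.
  by apply: i_upU; do 2!apply: image_subcat_fobj.
- move=> X; have [P [Q [x [y [cxy VP UQ]]]]] := app (i_low R X).
  have [u ui] := i_shr_low_iso X.
  exists (i_shr R P), (i_shr R Q), (fmor (i_shr R) x), (u ∘ fmor (i_shr R) y).
  split; [exact: conflation_iso_r (i_shrc cxy) ui | | exact: shr_up].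
  exact: image_subcat_fobj.
- move=> X; have [P [Q [x [y [cxy VP UQ]]]]] := coapp (i_low R X).
  exists (i_shr R P), (i_shr R Q), (fmor (i_shr R) x ∘ unit_ (adj_i_low_shr R) X),
    (fmor (i_shr R) y).
  split; [exact: conflation_iso_l (i_shrc cxy) (i_unit X) | | exact: shr_up].
  exact: image_subcat_fobj.
Qed.

Lemma restricted_cotorsion_pair_C :
  subcat_incl (image_subcat (j_low R) (image_subcat (j_up R) V)) V \/
  subcat_incl (image_subcat (j_shr R) (image_subcat (j_up R) U)) U ->
  cotorsion_pair (image_subcat (j_up R) U) (image_subcat (j_up R) V).
Proof.
case: cotUV => sU sV van app coapp stable.
split; try exact: image_subcat_iso.
- move=> X Y [P [UP XP]] [Q [VQ YQ]].
  apply: (ext_isomorphic_l XP); apply: (ext_isomorphic_r YQ).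
  case: stable => stable.
    apply: (ext_vanishes_L (adj_j_up_low R) j_low_preserves_conflations).
    by apply: van => //; apply: stable; do 2!apply: image_subcat_fobj.
  apply: (ext_vanishes_R (adj_j_shr_up R) j_shrc).
  by apply: van => //; apply: stable; do 2!apply: image_subcat_fobj.
- move=> X; have [P [Q [x [y [cxy VP UQ]]]]] := app (j_low R X).
  exists (j_up R P), (j_up R Q), (fmor (j_up R) x),
    (counit (adj_j_up_low R) X ∘ fmor (j_up R) y).
  split; [exact: conflation_iso_r (j_upc cxy) (j_counit X) | | ];
    exact: image_subcat_fobj.
- move=> X; have [P [Q [x [y [cxy VP UQ]]]]] := coapp (j_low R X).
  have [u ui] := isomorphic_sym (j_up_low_iso X).
  exists (j_up R P), (j_up R Q), (fmor (j_up R) x ∘ u), (fmor (j_up R) y).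
  split; [exact: conflation_iso_l (j_upc cxy) ui | | ];
    exact: image_subcat_fobj.
Qed.

End Restriction.
End Recollement.

Theorem theorem4p4 (A B C : ExtriCat)
    (wicA : WIC A) (wicB : WIC B) (wicC : WIC C)
    (R : Recollement A B C)
    (T1 F1 : A -> Prop) (T2 F2 : C -> Prop)
    (cot1 : cotorsion_pair T1 F1) (cot2 : cotorsion_pair T2 F2)
    (projB : enough_projectives B)
    (i_shr_exact : exact_functor (i_shr R))
    (j_shr_exact : exact_functor (j_shr R)) :
  let T := glued_T R T1 T2 in
  let F := glued_F R F1 F2 in
  (* (1) *)
  ((* (i) *) ext_vanishes T F \/
   (* (ii) *) exact_functor (i_up R) \/
   (* (iii) *)
   (forall (X : A) (Y : C), T2 Y ->
    forall f : Mor (i_low R X) (j_shr R Y),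
    forall Z : B, F Z ->
    forall g : Mor (i_low R X) Z,
    exists h : Mor (j_shr R Y) Z, h ∘ f = g) \/
   (* (iv) *)
   (subcat_incl T (image_subcat (j_shr R) T2) \/
    subcat_incl (image_subcat (i_low R) F1) (perp1 T)) \/
   (* (v) *) (Frobenius A /\ Frobenius B) ->
   cotorsion_pair T F) /\
  (* (2) *)
  (forall U V : B -> Prop, cotorsion_pair U V ->
   subcat_incl (image_subcat (i_low R) (image_subcat (i_shr R) U)) U ->
   subcat_incl (image_subcat (i_low R) (image_subcat (i_up R) U)) U ->
   cotorsion_pair (image_subcat (i_up R) U) (image_subcat (i_shr R) V)) /\
  (* (3) *)
  (forall U V : B -> Prop, cotorsion_pair U V ->
   subcat_incl (image_subcat (j_low R) (image_subcat (j_up R) V)) V \/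
   subcat_incl (image_subcat (j_shr R) (image_subcat (j_up R) U)) U ->
   cotorsion_pair (image_subcat (j_up R) U) (image_subcat (j_up R) V)).
Proof.
move=> T F; split=> [cases|].
  apply: glued_cotorsion_pair => //.
  case: cases => [// | [i_up_exact | [extend | [[inT | inF] | [FrobA FrobB]]]]].
  - apply: ext_vanishes_of_i_up => //; exact: exact_preserves_conflations.
  - exact: ext_vanishes_of_extension.
  - exact: ext_vanishes_of_T_in_j_shr.
  - exact: ext_vanishes_of_i_low_F1.
  - apply: ext_vanishes_of_i_up => //; exact: Frobenius_i_up_preserves_conflations.
split=> U V cotUV; first exact: restricted_cotorsion_pair_A.
exact: restricted_cotorsion_pair_C.
Qed.
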